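(* Let $(H,\beta)$ be a Hom-bialgebra over a field $K$ and let $(C,\rho,\alpha)$ be an $(H,\beta)$-comodule Hom-coalgebra, with $\rho(c)=c_{-1}\otimes c_0$. Then the vector space $C\otimes H$, equipped with the automorphism $\alpha\otimes\beta$, the comultiplication $$\Delta(c\otimes h)=c_1\otimes c_{2\,-1}\,\beta^{-1}(h_1)\otimes \alpha^{-1}(c_{2\,0})\otimes h_2\qquad(c\in C,\ h\in H)$$ (where $c_{2\,-1}\otimes c_{2\,0}=\rho(c_2)$, and the right-hand side lies in $(C\otimes H)\otimes(C\otimes H)$), and the counit $\varepsilon_C\otimes\varepsilon_H$, is a Hom-coalgebra. (It is called the smash coproduct Hom-coalgebra and denoted $(C\diamond H,\alpha\otimes\beta)$.)
   Context: All spaces are over a field $K$. Sweedler-type notation: $\Delta(c)=c_1\otimes c_2$, $\Delta(c_1)=c_{11}\otimes c_{12}$, etc., summation understood. Hom-algebra $(A,\mu,1_A,\alpha)$ (abbr. $(A,\alpha)$): a vector space $A$, a linear map $\mu:A\otimes A\to A$, $a\otimes a'\mapsto aa'$, an element $1_A\in A$ and a bijective linear map $\alpha:A\to A$ with $\alpha(aa')=\alpha(a)\alpha(a')$, $\alpha(1_A)=1_A$, $\alpha(a)(a'a'')=(aa')\alpha(a'')$, $a1_A=1_Aa=\alpha(a)$. Hom-coalgebra $(C,\Delta,\varepsilon_C,\beta)$ (abbr. $(C,\beta)$): a vector space $C$, linear maps $\Delta:C\to C\otimes C$, $\varepsilon_C:C\to K$ and a bijective linear map $\beta:C\to C$ with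 $\Delta(\beta(c))=\beta(c_1)\otimes\beta(c_2)$, $\varepsilon_C\circ\beta=\varepsilon_C$, $\beta(c_1)\otimes c_{21}\otimes c_{22}=c_{11}\otimes c_{12}\otimes\beta(c_2)$, $\varepsilon_C(c_1)c_2=c_1\varepsilon_C(c_2)=\beta(c)$. Hom-bialgebra $(H,\mu,1_H,\Delta,\varepsilon,\beta)$ (abbr. $(H,\beta)$): $(H,\mu,1_H,\beta)$ is a Hom-algebra, $(H,\Delta,\varepsilon,\beta)$ is a Hom-coalgebra, and $\Delta(hh')=h_1h'_1\otimes h_2h'_2$, $\Delta(1_H)=1_H\otimes1_H$, $\varepsilon(hh')=\varepsilon(h)\varepsilon(h')$, $\varepsilon(1_H)=1$. Left $(C,\beta)$-Hom-comodule $(M,\rho,\alpha)$ over a Hom-coalgebra $(C,\beta)$: a vector space $M$, a linear map $\rho:M\to C\otimes M$, $\rho(m)=m_{-1}\otimes m_0$, and a bijective linear map $\alpha:M\to M$ with $\rho(\alpha(m))=\beta(m_{-1})\otimes\alpha(m_0)$, $\beta(m_{-1})\otimes m_{0\,-1}\otimes m_{0\,0}=m_{-1\,1}\otimes m_{-1\,2}\otimes\alpha(m_0)$, $\varepsilon_C(m_{-1})m_0=\alpha(m)$. $(H,\beta)$-comodule Hom-coalgebra $(C,\rho,\alpha)$ over a Hom-bialgebra $(H,\beta)$: $(C,\alpha)$ is a Hom-coalgebra, $(C,\rho,\alpha)$ is a left $(H,\beta)$-Hom-comodule, and $\beta^2(c_{-1})\otimes c_{0\,1}\otimes c_{0\,2}=c_{1\,-1}c_{2\,-1}\otimes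 c_{1\,0}\otimes c_{2\,0}$, $c_{-1}\varepsilon_C(c_0)=1_H\varepsilon_C(c)$ for all $c\in C$. *)

(* Defs.v *)
From HB Require Import structures.
From mathcomp Require Import all_boot all_algebra.
From mathcomp Require Import freeg boolp.

Set Implicit Arguments.
Unset Strict Implicit.
Unset Printing Implicit Defensive.

Import GRing.Theory.
Local Open Scope ring_scope.
Local Open Scope quotient_scope.

Reserved Notation "U ⨂ V" (at level 38, right associativity).
Reserved Notation "x ⊗ y" (at level 38, right associativity).
Reserved Notation "\tsum_ ( x ⊗ y <- t ) E"
  (at level 41, x name, y name, t at level 200, E at level 41, right associativity,
   format "'[' \tsum_ ( x  ⊗  y  <-  t ) '/  '  E ']'").

(******************************************************************************)
(* Tensor product of two vector spaces: the free vector space on the pairs    *)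
(* (u, v), modulo the subspace spanned by the bilinearity relations.          *)
(*             U ⨂ V == the tensor product of U and V (right associative)     *)
(*             u ⊗ v == the pure tensor of u and v                            *)
(* \tsum_(x ⊗ y <- t) E x y == the value at t of the linear map sending       *)
(*                      u ⊗ v to E u v, for E bilinear; this is the Sweedler  *)
(*                      summation t = x ⊗ y.  It is a total function of E,    *)
(*                      computed on a chosen representative of t, and it is   *)
(*                      only meaningful for a bilinear E (see tliftE).        *)
(******************************************************************************)
Section Tensor.
Variables (K : fieldType) (U V : lmodType K).

Definition tensor_free : Type := {freeg (U * V)%type / K}.
HB.instance Definition _ := GRing.Lmodule.on tensor_free.

Definition fgen (u : U) (v : V) : tensor_free := << (u, v) >>.

Inductive tensor_null : tensor_free -> Prop :=
| TNull0 : tensor_null 0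
| TNullP a x y : tensor_null x -> tensor_null y -> tensor_null (a *: x + y)
| TNullL a u u' v :
    tensor_null (fgen (a *: u + u') v - (a *: fgen u v + fgen u' v))
| TNullR a u v v' :
    tensor_null (fgen u (a *: v + v') - (a *: fgen u v + fgen u v')).

Definition tnull (x : tensor_free) : bool := `[< tensor_null x >].

Lemma tnull_zmod : zmod_closed tnull.
Proof.
split=> [|x y /asboolP xN /asboolP yN]; apply/asboolP; first exact: TNull0.
by rewrite addrC -scaleN1r; apply: TNullP.
Qed.
HB.instance Definition _ :=
  GRing.isZmodClosed.Build tensor_free tnull tnull_zmod.

Definition tensor : Type := Quotient.quot (GRing.ZmodClosed.clone tensor_free tnull _).
HB.instance Definition _ := GRing.Zmodule.on tensor.
HB.instance Definition _ := Quotient.on tensor.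

Local Notation pi := (\pi_tensor : tensor_free -> tensor).

Lemma tpiP x y : reflect (tensor_null (x - y)) (pi x == pi y).
Proof. by rewrite -[_ == _]Quotient.idealrBE; apply: asboolP. Qed.

Lemma tpi_eq x y : tensor_null (x - y) -> pi x = pi y.
Proof. by move=> /tpiP/eqP. Qed.

Lemma tpiD x y : pi (x + y) = pi x + pi y.
Proof. exact: Quotient.pi_add. Qed.

Definition tscale (a : K) (t : tensor) : tensor := pi (a *: repr t).

Lemma tpiZ a x : pi (a *: x) = tscale a (pi x).
Proof.
apply: tpi_eq; rewrite -scalerBr -[_ *: _]addr0; apply: TNullP TNull0.
by apply/tpiP; rewrite reprK.
Qed.

Fact tscaleA a b t : tscale a (tscale b t) = tscale (a * b) t.
Proof.
by elim/quotW: t => x; rewrite -(tpiZ b x) -(tpiZ a) scalerA (tpiZ _ x).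
Qed.
Fact tscale1 : left_id 1 tscale.
Proof. by elim/quotW=> x; rewrite -tpiZ scale1r. Qed.
Fact tscaleDr : right_distributive tscale +%R.
Proof.
move=> a; elim/quotW=> x; elim/quotW=> y.
by rewrite -(tpiD x y) -(tpiZ a) scalerDr tpiD !tpiZ.
Qed.
Fact tscaleDl t : {morph tscale^~ t : a b / a + b}.
Proof.
by elim/quotW: t => x a b; rewrite -(tpiZ (a + b)) scalerDl tpiD !tpiZ.
Qed.

HB.instance Definition _ :=
  GRing.Zmodule_isLmodule.Build K tensor tscaleA tscale1 tscaleDr tscaleDl.

Lemma tpi_linear : linear pi.
Proof. by move=> a x y; rewrite tpiD tpiZ. Qed.
HB.instance Definition _ :=
  GRing.isLinear.Build K tensor_free tensor *:%R pi tpi_linear.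

Definition tens (u : U) (v : V) : tensor := pi (fgen u v).

End Tensor.

Notation "U ⨂ V" := (tensor U V).
Notation "u ⊗ v" := (tens u v) : ring_scope.

Section TensorLift.
Variables (K : fieldType) (U V W : lmodType K).

Definition tlift (E : U -> V -> W) (t : U ⨂ V) : W :=
  fglift (fun z => E z.1 z.2) (repr t : tensor_free U V).

End TensorLift.

Notation "\tsum_ ( x ⊗ y <- t ) E" := (tlift (fun x y => E) t) : ring_scope.


Section FreeLift.
Variables (K : fieldType) (T : choiceType) (W : lmodType K) (f : T -> W).

Lemma fglift_linear : linear (fglift f : {freeg T / K} -> W).
Proof.
have fD : {morph (fglift f : {freeg T / K} -> W) : x y / x + y}.
  move=> x y; have H := @lift_is_additive K T W f.
  have H0 : fglift f 0 = 0 by rewrite -(subrr 0) H subrr.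
  by rewrite -[y in LHS]opprK H -[- y]sub0r H H0 sub0r opprK.
have f0 : fglift f 0 = 0 by apply: (addIr (fglift f 0)); rewrite -fD !add0r.
move=> a x y; rewrite fD; congr (_ + _).
rewrite -[x in RHS]freeg_sumE [a *: x]/(fgscale a x) /fgscale.
rewrite !(big_morph _ fD f0) scaler_sumr.
by apply: eq_bigr => z _; rewrite !liftU scalerA.
Qed.
HB.instance Definition _ :=
  GRing.isLinear.Build K {freeg T / K} W *:%R (fglift f) fglift_linear.

End FreeLift.

Lemma linear_comp (K : fieldType) (U V W : lmodType K) (f : V -> W)
  (g : U -> V) : linear f -> linear g -> linear (fun x => f (g x)).
Proof. by move=> fl gl a x y; rewrite gl fl. Qed.

Section TensorTheory.
Variables (K : fieldType) (U V : lmodType K).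
Implicit Types (u : U) (v : V) (t : U ⨂ V).

Lemma tens_linearl v : linear (fun u => u ⊗ v).
Proof.
by move=> a u u'; rewrite /tens -tpi_linear; exact/tpi_eq/TNullL.
Qed.

Lemma tens_linearr u : linear (fun v => u ⊗ v).
Proof.
by move=> a v v'; rewrite /tens -tpi_linear; exact/tpi_eq/TNullR.
Qed.

Lemma tensor_sum t : exists s : seq (U * V), t = \sum_(z <- s) z.1 ⊗ z.2.
Proof.
rewrite -[t]reprK; set x : tensor_free U V := repr t.
rewrite -[x]freeg_sumE; elim: (dom x) => [|z r [s IHs]].
  by exists [::]; rewrite !big_nil [LHS]linear0.
exists ((coeff z x *: z.1, z.2) :: s).
rewrite !big_cons /= tpiD; congr (_ + _); last exact: IHs.
have -> : << coeff z x *g z >> = coeff z x *: fgen z.1 z.2 :> tensor_free U V.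
  apply/eqP/freeg_eqP => y.
  by rewrite [RHS]coeffZ !coeffU -surjective_pairing mul1r.
rewrite [LHS]linearZ; symmetry.
exact: (GRing.scalable_linear (tens_linearl z.2)).
Qed.

Section Lift.
Variables (W : lmodType K).
Implicit Type E : U -> V -> W.

Lemma tlift_param (X : lmodType K) (E : X -> U -> V -> W) t :
  (forall u v, linear (fun x => E x u v)) -> linear (fun x => tlift (E x) t).
Proof.
move=> El a x y; pose D : tensor_free U V := repr t.
have fgliftE (f : U * V -> W) :
    fglift f (repr t : tensor_free U V) = \sum_(z <- dom D) coeff z D *: f z.
  rewrite -/D -[D in LHS]freeg_sumE linear_sum.
  by apply: eq_bigr => z _; apply: liftU.
rewrite /tlift !fgliftE scaler_sumr -big_split /=.
by apply: eq_bigr => z _; rewrite El scalerDr !scalerA mulrC.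
Qed.

Variable E : U -> V -> W.
Hypothesis El : forall v, linear (fun u => E u v).
Hypothesis Er : forall u, linear (E u).

Lemma tlift_pi (x : tensor_free U V) :
  tlift E (\pi x) = fglift (fun z => E z.1 z.2) x.
Proof.
have null0 y : tensor_null y -> fglift (fun z => E z.1 z.2) y = 0.
  elim=> [|a y1 y2 _ IH1 _ IH2|a u u' v|a u v v']; first exact: raddf0.
  - by rewrite linearP /= IH1 IH2 scaler0 addr0.
  - by rewrite linearB linearP /= !liftU !scale1r /= El subrr.
  - by rewrite linearB linearP /= !liftU !scale1r /= Er subrr.
apply/eqP; rewrite -subr_eq0 /tlift -linearB /=.
by apply/eqP/null0/tpiP; rewrite reprK.
Qed.

Lemma tliftE u v : tlift E (u ⊗ v) = E u v.
Proof. by rewrite tlift_pi liftU scale1r. Qed.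

Lemma tlift_linear : linear (tlift E).
Proof.
move=> a s t; rewrite -[s]reprK -[t]reprK -tpi_linear !tlift_pi.
exact: linearP.
Qed.

End Lift.

Lemma tensor_ext (W : lmodType K) (f g : U ⨂ V -> W) :
  linear f -> linear g -> (forall u v, f (u ⊗ v) = g (u ⊗ v)) -> f =1 g.
Proof.
move=> fl gl fg t.
pose f' : {linear _ -> _} := HB.pack f (GRing.isLinear.Build K _ W *:%R f fl).
pose g' : {linear _ -> _} := HB.pack g (GRing.isLinear.Build K _ W *:%R g gl).
have [s ->] := tensor_sum t; rewrite -[f]/(f' : _ -> _) -[g]/(g' : _ -> _).
by rewrite !linear_sum; apply: eq_bigr => z _; apply: fg.
Qed.

End TensorTheory.

Section TensorMap.
Variables (K : fieldType) (U V U' V' : lmodType K).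
Variables (f : {linear U -> U'}) (g : {linear V -> V'}).

Definition tmap (t : U ⨂ V) : U' ⨂ V' := \tsum_(u ⊗ v <- t) f u ⊗ g v.

Fact tmap_linearl v : linear (fun u => f u ⊗ g v).
Proof. by move=> a x y; rewrite linearP tens_linearl. Qed.
Fact tmap_linearr u : linear (fun v => f u ⊗ g v).
Proof. by move=> a x y; rewrite linearP tens_linearr. Qed.
HB.instance Definition _ := GRing.isLinear.Build K (U ⨂ V) (U' ⨂ V') *:%R tmap
  (tlift_linear tmap_linearl tmap_linearr).

Lemma tmapE u v : tmap (u ⊗ v) = f u ⊗ g v.
Proof. exact: (tliftE tmap_linearl tmap_linearr). Qed.

End TensorMap.

(* The inverse of a bijective linear map; the identity if f is not bijective, *)
(* so that linv f is linear for every f.                                      *)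
Section LinearInverse.
Variables (K : fieldType) (V : lmodType K) (f : {linear V -> V}).

Lemma bijective_surj : bijective f -> forall y, exists x, f x = y.
Proof. by case=> g _ fK y; exists (g y). Qed.

Definition linv (y : V) : V :=
  if pselect (bijective f) is left fbij
  then projT1 (cid (bijective_surj fbij y)) else y.

Lemma linvK : bijective f -> cancel linv f.
Proof.
by move=> fbij y; rewrite /linv; case: pselect => // ?; case: cid.
Qed.

Lemma linKv : bijective f -> cancel f linv.
Proof. by move=> fbij x; apply: (bij_inj fbij); rewrite linvK. Qed.

Fact linv_linear : linear linv.
Proof.
move=> a x y; have [fbij|nbij] := pselect (bijective f).
  by apply: (bij_inj fbij); rewrite linearP !linvK.
by rewrite /linv; case: pselect.
Qed.
HB.instance Definition _ := GRing.isLinear.Build K V V *:%R linv linv_linear.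

End LinearInverse.

Section HomStructures.
Variable K : fieldType.

Record hom_algebra (A : lmodType K) (mu : {linear A ⨂ A -> A}) (e : A)
    (alpha : {linear A -> A}) : Prop := HomAlgebra {
  halg_bij : bijective alpha;
  halg_morphM a b : alpha (mu (a ⊗ b)) = mu (alpha a ⊗ alpha b);
  halg_morph1 : alpha e = e;
  halg_assoc a b c : mu (alpha a ⊗ mu (b ⊗ c)) = mu (mu (a ⊗ b) ⊗ alpha c);
  halg_mulr1 a : mu (a ⊗ e) = alpha a;
  halg_mul1r a : mu (e ⊗ a) = alpha a }.

Record hom_coalgebra (C : lmodType K) (Delta : {linear C -> C ⨂ C})
    (eps : {scalar C}) (beta : {linear C -> C}) : Prop := HomCoalgebra {
  hcoalg_bij : bijective beta;
  hcoalg_morph c :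
    Delta (beta c) = \tsum_(c1 ⊗ c2 <- Delta c) beta c1 ⊗ beta c2;
  hcoalg_eps c : eps (beta c) = eps c;
  hcoalg_coassoc c :
    \tsum_(c1 ⊗ c2 <- Delta c) \tsum_(c21 ⊗ c22 <- Delta c2)
      beta c1 ⊗ c21 ⊗ c22
    = \tsum_(c1 ⊗ c2 <- Delta c) \tsum_(c11 ⊗ c12 <- Delta c1)
      c11 ⊗ c12 ⊗ beta c2;
  hcoalg_counitl c : \tsum_(c1 ⊗ c2 <- Delta c) eps c1 *: c2 = beta c;
  hcoalg_counitr c : \tsum_(c1 ⊗ c2 <- Delta c) eps c2 *: c1 = beta c }.

Record hom_bialgebra (H : lmodType K) (mu : {linear H ⨂ H -> H}) (e : H)
    (Delta : {linear H -> H ⨂ H}) (eps : {scalar H})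
    (beta : {linear H -> H}) : Prop := HomBialgebra {
  hbialg_alg : hom_algebra mu e beta;
  hbialg_coalg : hom_coalgebra Delta eps beta;
  hbialg_comulM h k :
    Delta (mu (h ⊗ k))
    = \tsum_(h1 ⊗ h2 <- Delta h) \tsum_(k1 ⊗ k2 <- Delta k)
      mu (h1 ⊗ k1) ⊗ mu (h2 ⊗ k2);
  hbialg_comul1 : Delta e = e ⊗ e;
  hbialg_counitM h k : eps (mu (h ⊗ k)) = eps h * eps k;
  hbialg_counit1 : eps e = 1 }.

Record hom_comodule (C : lmodType K) (Delta : {linear C -> C ⨂ C})
    (eps : {scalar C}) (beta : {linear C -> C}) (M : lmodType K)
    (rho : {linear M -> C ⨂ M}) (alpha : {linear M -> M}) : Prop := HomComodule {
  hcomod_bij : bijective alpha;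
  hcomod_morph m :
    rho (alpha m) = \tsum_(c ⊗ m0 <- rho m) beta c ⊗ alpha m0;
  hcomod_coassoc m :
    \tsum_(c ⊗ m0 <- rho m) \tsum_(c' ⊗ m00 <- rho m0) beta c ⊗ c' ⊗ m00
    = \tsum_(c ⊗ m0 <- rho m) \tsum_(c1 ⊗ c2 <- Delta c) c1 ⊗ c2 ⊗ alpha m0;
  hcomod_counit m : \tsum_(c ⊗ m0 <- rho m) eps c *: m0 = alpha m }.

Record comodule_hom_coalgebra (H : lmodType K) (mu : {linear H ⨂ H -> H})
    (e : H) (DeltaH : {linear H -> H ⨂ H}) (epsH : {scalar H})
    (beta : {linear H -> H}) (C : lmodType K) (DeltaC : {linear C -> C ⨂ C})
    (epsC : {scalar C}) (rho : {linear C -> H ⨂ C})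
    (alpha : {linear C -> C}) : Prop := ComoduleHomCoalgebra {
  chcoalg_coalg : hom_coalgebra DeltaC epsC alpha;
  chcoalg_comod : hom_comodule DeltaH epsH beta rho alpha;
  chcoalg_comul c :
    \tsum_(h ⊗ c0 <- rho c) \tsum_(c01 ⊗ c02 <- DeltaC c0)
      beta (beta h) ⊗ c01 ⊗ c02
    = \tsum_(c1 ⊗ c2 <- DeltaC c)
      \tsum_(h1 ⊗ c10 <- rho c1) \tsum_(h2 ⊗ c20 <- rho c2)
      mu (h1 ⊗ h2) ⊗ c10 ⊗ c20;
  chcoalg_counit c : \tsum_(h ⊗ c0 <- rho c) epsC c0 *: h = epsC c *: e }.

End HomStructures.

Section SmashCoproduct.
Variables (K : fieldType) (H C : lmodType K).
Variables (mu : {linear H ⨂ H -> H}) (DeltaH : {linear H -> H ⨂ H}).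
Variables (beta : {linear H -> H}) (DeltaC : {linear C -> C ⨂ C}).
Variables (rho : {linear C -> H ⨂ C}) (alpha : {linear C -> C}).
Variables (epsC : {scalar C}) (epsH : {scalar H}).

Definition smash_comul_pure (c : C) (h : H) : (C ⨂ H) ⨂ (C ⨂ H) :=
  \tsum_(c1 ⊗ c2 <- DeltaC c) \tsum_(k ⊗ c20 <- rho c2)
  \tsum_(h1 ⊗ h2 <- DeltaH h)
    (c1 ⊗ mu (k ⊗ linv beta h1)) ⊗ (linv alpha c20 ⊗ h2).

Definition smash_comul (t : C ⨂ H) : (C ⨂ H) ⨂ (C ⨂ H) :=
  \tsum_(c ⊗ h <- t) smash_comul_pure c h.

Definition smash_counit (t : C ⨂ H) : K :=
  \tsum_(c ⊗ h <- t) (epsC c * epsH h : K^o).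

Let E (c1 : C) (k : H) (c20 : C) (h1 h2 : H) :=
  (c1 ⊗ mu (k ⊗ linv beta h1)) ⊗ (linv alpha c20 ⊗ h2).

Let E1 k c20 h1 h2 : linear (fun c1 => E c1 k c20 h1 h2).
Proof. by move=> a x y; rewrite /E !tens_linearl. Qed.
Let E2 c1 c20 h1 h2 : linear (fun k => E c1 k c20 h1 h2).
Proof.
by move=> a x y; rewrite /E tens_linearl linearP tens_linearr tens_linearl.
Qed.
Let E3 c1 k h1 h2 : linear (fun c20 => E c1 k c20 h1 h2).
Proof. by move=> a x y; rewrite /E linearP tens_linearl tens_linearr. Qed.
Let E4 c1 k c20 h2 : linear (fun h1 => E c1 k c20 h1 h2).
Proof.
by move=> a x y;
   rewrite /E linearP tens_linearr linearP tens_linearr tens_linearl.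
Qed.
Let E5 c1 k c20 h1 : linear (fun h2 => E c1 k c20 h1 h2).
Proof. by move=> a x y; rewrite /E !tens_linearr. Qed.

Fact smash_comul_pure_linearl h : linear (smash_comul_pure ^~ h).
Proof.
pose F c1 c2 := \tsum_(k ⊗ c20 <- rho c2) \tsum_(h1 ⊗ h2 <- DeltaH h)
  E c1 k c20 h1 h2.
apply: (@linear_comp _ _ _ _ (tlift F) DeltaC); last exact: linearP.
apply: tlift_linear => [c2|c1].
  by do 2!apply: tlift_param => ? ?.
apply: (@linear_comp _ _ _ _ (tlift _) rho); last exact: linearP.
by apply: tlift_linear => ?; apply: tlift_param => ? ?.
Qed.

Fact smash_comul_pure_linearr c : linear (smash_comul_pure c).
Proof.
do 2!apply: tlift_param => ? ?.
apply: (@linear_comp _ _ _ _ (tlift _) DeltaH); last exact: linearP.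
by apply: tlift_linear => ?; [apply: E4 | apply: E5].
Qed.

HB.instance Definition _ := GRing.isLinear.Build K (C ⨂ H) _ *:%R smash_comul
  (tlift_linear smash_comul_pure_linearl smash_comul_pure_linearr).

Lemma smash_comulE c h :
  smash_comul (c ⊗ h) =
  \tsum_(c1 ⊗ c2 <- DeltaC c) \tsum_(k ⊗ c20 <- rho c2)
  \tsum_(h1 ⊗ h2 <- DeltaH h)
    (c1 ⊗ mu (k ⊗ linv beta h1)) ⊗ (linv alpha c20 ⊗ h2).
Proof.
exact: (tliftE smash_comul_pure_linearl smash_comul_pure_linearr).
Qed.

Fact smash_counit_linearl h : linear (fun c => epsC c * epsH h : K^o).
Proof. by move=> a x y; rewrite linearP mulrDl -mulrA. Qed.
Fact smash_counit_linearr c : linear (fun h => epsC c * epsH h : K^o).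
Proof. by move=> a x y; rewrite linearP mulrDr mulrCA. Qed.

HB.instance Definition _ := GRing.isLinear.Build K (C ⨂ H) K *%R smash_counit
  (tlift_linear smash_counit_linearl smash_counit_linearr).

Lemma smash_counitE c h : smash_counit (c ⊗ h) = epsC c * epsH h.
Proof. exact: (tliftE smash_counit_linearl smash_counit_linearr). Qed.

End SmashCoproduct.

(* Main.v *)
(**
Write h.k for the product of H and h_1, c_{-1}, etc. in Sweedler notation.
For coassociativity, both iterated coproducts of c (x) h are brought to

  alpha(c_1) (x) beta^-1(c_{21,-1}.c_{22,-1}).h_1 (x) alpha^-1(c_{21,0})
    (x) beta^-1(c_{22,0,-1}).beta^-1(h_{21}) (x) alpha^-2(c_{22,0,0}) (x) h_{22}.

On the left this is the compatibility of rho with the coproduct of C; on the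
right it follows from the coassociativity of C, of rho and of H, together with
h.beta^-1(k.l) = beta^-1(h.k).l.  The equations of the structure are applied
inside Sweedler sums by evaluating them against arbitrary trilinear maps.
*)
Require Import Defs.
From HB Require Import structures.
From mathcomp Require Import all_boot all_algebra.
From mathcomp Require Import freeg boolp.

Set Implicit Arguments.
Unset Strict Implicit.
Unset Printing Implicit Defensive.

Import GRing.Theory.
Local Open Scope ring_scope.

(** * Calculus of Sweedler sums *)

Section TensorSum.
Variables (K : fieldType) (U V : lmodType K).

(** The list comes from the chosen representative of [t] alone, so one list serves every target and
    every [E], bilinear or not. Sweedler sums can thus be handled as finite sums. *)
Lemma tlift_sum (t : U ⨂ V) : exists s : seq (K * (U * V)),
  forall (W : lmodType K) (E : U -> V -> W),
    tlift E t = \sum_(z <- s) z.1 *: E z.2.1 z.2.2.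
Proof.
pose D : tensor_free U V := repr t.
exists [seq (coeff z D, z) | z <- dom D] => W E.
rewrite /tlift -/D -[D in LHS]freeg_sumE linear_sum [RHS]big_map.
by apply: eq_bigr => z _; apply: liftU.
Qed.

Lemma eq_tlift (W : lmodType K) (E F : U -> V -> W) (t : U ⨂ V) :
  (forall u v, E u v = F u v) -> tlift E t = tlift F t.
Proof. by move=> EF; congr (tlift _ t); do 2!apply: funext => ?. Qed.

Lemma linear_tlift (W W' : lmodType K) (f : W -> W') (E : U -> V -> W)
  (t : U ⨂ V) : linear f -> f (tlift E t) = tlift (fun u v => f (E u v)) t.
Proof.
move=> fl; have [s sE] := tlift_sum t; rewrite !sE.
pose f' : {linear _ -> _} := HB.pack f (GRing.isLinear.Build K _ _ *:%R f fl).
rewrite -[f]/(f' : _ -> _) linear_sum.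
by apply: eq_bigr => z _; rewrite linearZ.
Qed.

End TensorSum.

(** Fubini for finite sums; it aligns the order of independent Sweedler sums. *)
Lemma exchange_tlift (K : fieldType) (U V U' V' W : lmodType K)
    (E : U -> V -> U' -> V' -> W)
    (t : U ⨂ V) (t' : U' ⨂ V') :
  tlift (fun u v => tlift (E u v) t') t =
  tlift (fun u' v' => tlift (fun u v => E u v u' v') t) t'.
Proof.
have [s' s'E] := tlift_sum t'; have [s sE] := tlift_sum t.
rewrite sE s'E; under eq_bigr do rewrite s'E scaler_sumr.
under [RHS]eq_bigr do rewrite sE scaler_sumr.
rewrite exchange_big; apply: eq_bigr => z _; apply: eq_bigr => y _.
by rewrite !scalerA mulrC.
Qed.

(** * Stability of linearity, and its automation *)

Section LinearIn.
Variables (K : fieldType) (X U V W : lmodType K).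

Lemma linear_id : linear (fun x : X => x).
Proof. by []. Qed.

Lemma linear_map (g : {linear U -> V}) (f : X -> U) :
  linear f -> linear (fun x => g (f x)).
Proof. by move=> fl; apply: linear_comp fl; apply: linearP. Qed.

Lemma linear_tensl (f : X -> U) (v : V) :
  linear f -> linear (fun x => f x ⊗ v).
Proof. by move=> fl a x y; rewrite fl tens_linearl. Qed.

Lemma linear_tensr (f : X -> V) (u : U) :
  linear f -> linear (fun x => u ⊗ f x).
Proof. by move=> fl a x y; rewrite fl tens_linearr. Qed.

Lemma linear_scalel (g : {scalar U}) (f : X -> U) (v : V) :
  linear f -> linear (fun x => g (f x) *: v).
Proof. by move=> fl a x y; rewrite fl linearP scalerDl scalerA. Qed.

Lemma linear_scaler (f : X -> U) (a : K) :
  linear f -> linear (fun x => a *: f x).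
Proof. by move=> fl b x y; rewrite fl scalerDr !scalerA mulrC. Qed.

Lemma linear_tliftr (E : U -> V -> W) (f : X -> U ⨂ V) :
  (forall v, linear (fun u => E u v)) -> (forall u, linear (E u)) ->
  linear f -> linear (fun x => tlift E (f x)).
Proof. by move=> El Er fl a x y; rewrite fl tlift_linear. Qed.

End LinearIn.

(* [refine] may postpone a higher-order constraint that the body of the sum   *)
(* does not involve x; solving it at once decides between the two tlift rules.*)
Ltac prove_linear := cbv beta;
  lazymatch goal with
  | |- forall x, _ => let u := fresh "u" in intro u; prove_linear
  | |- GRing.linear_for _ (fun x => x) => refine (@linear_id _ _)
  | |- GRing.linear_for _ (fun x => tens _ _) =>
      first [ refine (@linear_tensl _ _ _ _ _ _ _)
            | refine (@linear_tensr _ _ _ _ _ _ _) ]; prove_linear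
  | |- GRing.linear_for _ (fun x => tlift _ _) =>
      first [ refine (@linear_tliftr _ _ _ _ _ _ _ _ _ _); solve_constraints
            | refine (@tlift_param _ _ _ _ _ _ _ _) ]; prove_linear
  | |- GRing.linear_for _ (fun x => _ *: _) =>
      first [ refine (@linear_scaler _ _ _ _ _ _)
            | refine (@linear_scalel _ _ _ _ _ _ _ _) ]; prove_linear
  | |- GRing.linear_for _ (fun x => _ _) =>
      refine (@linear_map _ _ _ _ _ _ _); prove_linear
  | |- _ => first [ exact: linearP | exact: tens_linearr ]
  end.

Lemma tensZl (K : fieldType) (U V : lmodType K) (a : K) (u : U) (v : V) :
  (a *: u) ⊗ v = a *: (u ⊗ v).
Proof. exact: (GRing.scalable_linear (tens_linearl v)). Qed.

Lemma tensZr (K : fieldType) (U V : lmodType K) (a : K) (u : U) (v : V) :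
  u ⊗ (a *: v) = a *: (u ⊗ v).
Proof. exact: (GRing.scalable_linear (tens_linearr u)). Qed.

(** Substitution: when the tensor summed over is itself a Sweedler sum, bilinearity of [E] lets that
    sum be pulled outside. *)
Lemma tlift_tlift (K : fieldType) (U V U' V' W : lmodType K)
    (E : U' -> V' -> W) (F : U -> V -> U' ⨂ V') (t : U ⨂ V) :
  (forall v, linear (fun u => E u v)) -> (forall u, linear (E u)) ->
  tlift E (tlift F t) = tlift (fun u v => tlift E (F u v)) t.
Proof. by move=> El Er; apply: linear_tlift; apply: tlift_linear. Qed.

(** * Trilinear maps on triple tensors *)

Definition trilinear (K : fieldType) (U V X W : lmodType K)
    (F : U -> V -> X -> W) : Prop :=
  [/\ forall v x, linear (fun u => F u v x),
      forall u x, linear (fun v => F u v x) & forall u v, linear (F u v)].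

(** For trilinear [F], this is the linear map induced by the universal property. *)
Definition tlift3 (K : fieldType) (U V X W : lmodType K)
    (F : U -> V -> X -> W) (t : U ⨂ V ⨂ X) : W :=
  \tsum_(u ⊗ s <- t) tlift (F u) s.

Section Trilinear.
Variables (K : fieldType) (U V X W : lmodType K) (F : U -> V -> X -> W).
Hypothesis F3 : trilinear F.

Let Fl t : linear (fun u => tlift (F u) t).
Proof. by case: F3 => Fu _ _; apply: tlift_param. Qed.
Let Fr u : linear (tlift (F u)).
Proof. by case: F3 => _ Fv Fx; apply: tlift_linear. Qed.

Lemma tlift3_linear : linear (tlift3 F).
Proof. exact: tlift_linear. Qed.

Lemma tlift3E u v x : tlift3 F (u ⊗ v ⊗ x) = F u v x.
Proof. by rewrite /tlift3 tliftE // tliftE; case: F3. Qed.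

Lemma tlift3_tlift2 (A B A' B' : lmodType K)
    (E : A -> B -> A' -> B' -> U ⨂ V ⨂ X)
    (s : A -> B -> A' ⨂ B') (t : A ⨂ B) :
  tlift3 F (\tsum_(a ⊗ b <- t) \tsum_(a' ⊗ b' <- s a b) E a b a' b') =
  \tsum_(a ⊗ b <- t) \tsum_(a' ⊗ b' <- s a b) tlift3 F (E a b a' b').
Proof.
rewrite (linear_tlift _ _ tlift3_linear); apply: eq_tlift => a b.
exact: (linear_tlift _ _ tlift3_linear).
Qed.

End Trilinear.

(** * Inverses of the twisting maps *)

Lemma tmap_can (K : fieldType) (U V U' V' : lmodType K)
    (f : {linear U -> U'}) (f' : {linear U' -> U})
    (g : {linear V -> V'}) (g' : {linear V' -> V}) :
  cancel f f' -> cancel g g' -> cancel (tmap f g) (tmap f' g').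
Proof.
move=> fK gK.
apply: (@tensor_ext _ _ _ _ (fun t => tmap f' g' (tmap f g t)) (fun t => t)).
- by prove_linear.
- by prove_linear.
- by move=> u v; rewrite !tmapE fK gK.
Qed.

Lemma tmap_bij (K : fieldType) (U V : lmodType K) (f : {linear U -> U})
    (g : {linear V -> V}) :
  bijective f -> bijective g -> bijective (tmap f g).
Proof.
move=> fbij gbij; exists (tmap (linv f) (linv g)); apply: tmap_can.
all: by [exact: linKv | exact: linvK].
Qed.

(** From d f = (g ⊗ h) d follows d f^-1 = (g^-1 ⊗ h^-1) d. This serves for the coproducts and the
    coaction alike. *)
Lemma tlift_linv (K : fieldType) (M N P W : lmodType K)
    (d : {linear M -> N ⨂ P}) (f : {linear M -> M}) (g : {linear N -> N})
    (h : {linear P -> P}) (E : N -> P -> W) (x : M) :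
  bijective f -> bijective g -> bijective h ->
  (forall x, d (f x) = \tsum_(u ⊗ v <- d x) g u ⊗ h v) ->
  (forall v, linear (fun u => E u v)) -> (forall u, linear (E u)) ->
  \tsum_(u ⊗ v <- d (linv f x)) E u v =
  \tsum_(u ⊗ v <- d x) E (linv g u) (linv h v).
Proof.
move=> fbij gbij hbij dE El Er.
have E'l v : linear (fun u => E (linv g u) (linv h v)).
  by move=> a y z; rewrite linearP El.
have E'r u : linear (fun v => E (linv g u) (linv h v)).
  by move=> a y z; rewrite linearP Er.
rewrite -[x in RHS](linvK fbij) dE tlift_tlift //.
by apply: eq_tlift => u v; rewrite tliftE // !linKv.
Qed.

(** * The axioms evaluated against multilinear maps *)

Section LiftedAxioms.
Variables (K : fieldType) (W : lmodType K).

Lemma hcoalg_coassoc_tlift (C : lmodType K) (Delta : {linear C -> C ⨂ C})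
    (eps : {scalar C}) (beta : {linear C -> C}) (F : C -> C -> C -> W) c :
  hom_coalgebra Delta eps beta -> trilinear F ->
  \tsum_(c1 ⊗ c2 <- Delta c) \tsum_(c21 ⊗ c22 <- Delta c2) F (beta c1) c21 c22
  = \tsum_(c1 ⊗ c2 <- Delta c) \tsum_(c11 ⊗ c12 <- Delta c1)
      F c11 c12 (beta c2).
Proof.
move=> hC F3; have := congr1 (tlift3 F) (hcoalg_coassoc hC c).
rewrite !(tlift3_tlift2 F3).
under eq_tlift => c1 c2 do under eq_tlift => c21 c22 do rewrite (tlift3E F3).
under [in RHS]eq_tlift => c1 c2 do
  under eq_tlift => c11 c12 do rewrite (tlift3E F3).
done.
Qed.

Lemma hcomod_coassoc_tlift (C : lmodType K) (Delta : {linear C -> C ⨂ C})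
    (eps : {scalar C}) (beta : {linear C -> C}) (M : lmodType K)
    (rho : {linear M -> C ⨂ M}) (alpha : {linear M -> M})
    (F : C -> C -> M -> W) m :
  hom_comodule Delta eps beta rho alpha -> trilinear F ->
  \tsum_(c ⊗ m0 <- rho m) \tsum_(c' ⊗ m00 <- rho m0) F (beta c) c' m00
  = \tsum_(c ⊗ m0 <- rho m) \tsum_(c1 ⊗ c2 <- Delta c) F c1 c2 (alpha m0).
Proof.
move=> hM F3; have := congr1 (tlift3 F) (hcomod_coassoc hM m).
rewrite !(tlift3_tlift2 F3).
under eq_tlift => c1 c2 do under eq_tlift => c21 c22 do rewrite (tlift3E F3).
under [in RHS]eq_tlift => c1 c2 do
  under eq_tlift => c11 c12 do rewrite (tlift3E F3).
done.
Qed.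

Lemma hbialg_comulM_tlift (H : lmodType K) (mu : {linear H ⨂ H -> H}) (e : H)
    (Delta : {linear H -> H ⨂ H}) (eps : {scalar H})
    (beta : {linear H -> H}) (E : H -> H -> W) h k :
  hom_bialgebra mu e Delta eps beta ->
  (forall v, linear (fun u => E u v)) -> (forall u, linear (E u)) ->
  \tsum_(u ⊗ v <- Delta (mu (h ⊗ k))) E u v
  = \tsum_(h1 ⊗ h2 <- Delta h) \tsum_(k1 ⊗ k2 <- Delta k)
      E (mu (h1 ⊗ k1)) (mu (h2 ⊗ k2)).
Proof.
move=> hH El Er; rewrite (hbialg_comulM hH) tlift_tlift //.
apply: eq_tlift => h1 h2; rewrite tlift_tlift //.
by apply: eq_tlift => k1 k2; rewrite tliftE.
Qed.

Lemma chcoalg_comul_tlift (H : lmodType K) (mu : {linear H ⨂ H -> H})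
    (e : H) (DeltaH : {linear H -> H ⨂ H}) (epsH : {scalar H})
    (beta : {linear H -> H}) (C : lmodType K) (DeltaC : {linear C -> C ⨂ C})
    (epsC : {scalar C}) (rho : {linear C -> H ⨂ C})
    (alpha : {linear C -> C}) (F : H -> C -> C -> W) c :
  comodule_hom_coalgebra mu e DeltaH epsH beta DeltaC epsC rho alpha ->
  trilinear F ->
  \tsum_(h ⊗ c0 <- rho c) \tsum_(c01 ⊗ c02 <- DeltaC c0)
    F (beta (beta h)) c01 c02
  = \tsum_(c1 ⊗ c2 <- DeltaC c)
    \tsum_(h1 ⊗ c10 <- rho c1) \tsum_(h2 ⊗ c20 <- rho c2)
    F (mu (h1 ⊗ h2)) c10 c20.
Proof.
move=> hC F3; have := congr1 (tlift3 F) (chcoalg_comul hC c).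
(* The right side nests three sums: the outermost is crossed here by linearity, the inner two below
   by [tlift3_tlift2]. *)
rewrite (tlift3_tlift2 F3) (linear_tlift _ _ (tlift3_linear F3)).
under eq_tlift => h c0 do under eq_tlift => c1 c2 do rewrite (tlift3E F3).
under [in RHS]eq_tlift => c1 c2 do
  [rewrite (tlift3_tlift2 F3);
   under eq_tlift => h1 c10 do
     under eq_tlift => h2 c20 do rewrite (tlift3E F3)].
done.
Qed.

End LiftedAxioms.

(** * The smash coproduct and its twisting map *)

Section SmashCoproduct.
Variables (K : fieldType) (H C : lmodType K).
Variables (mu : {linear H ⨂ H -> H}) (e : H) (DeltaH : {linear H -> H ⨂ H}).
Variables (epsH : {scalar H}) (beta : {linear H -> H}).
Variables (DeltaC : {linear C -> C ⨂ C}) (epsC : {scalar C}).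
Variables (rho : {linear C -> H ⨂ C}) (alpha : {linear C -> C}).
Hypothesis hH : hom_bialgebra mu e DeltaH epsH beta.
Hypothesis hC :
  comodule_hom_coalgebra mu e DeltaH epsH beta DeltaC epsC rho alpha.

Let Delta : {linear C ⨂ H -> (C ⨂ H) ⨂ (C ⨂ H)} :=
  smash_comul mu DeltaH beta DeltaC rho alpha.
Local Notation "x '⋅' y" := (mu (x ⊗ y)) (at level 36, right associativity).
Local Notation "x ^a" := (linv alpha x) (at level 2, format "x ^a").
Local Notation "x ^b" := (linv beta x) (at level 2, format "x ^b").

Let hA := hbialg_alg hH.
Let hHc := hbialg_coalg hH.
Let hCc := chcoalg_coalg hC.
Let hCm := chcoalg_comod hC.
Let bbij := hcoalg_bij hHc.
Let abij := hcoalg_bij hCc.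

Lemma smash_comul_tlift (W : lmodType K) (E : C ⨂ H -> C ⨂ H -> W) c h :
  (forall v, linear (fun u => E u v)) -> (forall u, linear (E u)) ->
  \tsum_(x ⊗ y <- Delta (c ⊗ h)) E x y =
  \tsum_(c1 ⊗ c2 <- DeltaC c) \tsum_(k ⊗ c20 <- rho c2)
  \tsum_(h1 ⊗ h2 <- DeltaH h) E (c1 ⊗ (k ⋅ h1^b)) (c20^a ⊗ h2).
Proof.
move=> El Er; rewrite /Delta /= smash_comulE tlift_tlift //.
apply: eq_tlift => c1 c2; rewrite tlift_tlift //.
apply: eq_tlift => k c20; rewrite tlift_tlift //.
by apply: eq_tlift => h1 h2; rewrite tliftE.
Qed.

Lemma linv_mul h k : (h ⋅ k)^b = h^b ⋅ k^b.
Proof.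
by apply: (bij_inj bbij); rewrite (halg_morphM hA) !linvK.
Qed.

(** Hom-associativity for the triple of preimages under [beta]. *)
Lemma mul_linvA h k l : h ⋅ (k ⋅ l)^b = (h ⋅ k)^b ⋅ l.
Proof.
by rewrite !linv_mul -[h in LHS](linvK bbij) (halg_assoc hA) linvK.
Qed.

(** On pure tensors the twisting maps pass through [DeltaC], [rho] and [DeltaH] in turn, then cancel
    the inverses in the formula. *)
Lemma smash_comul_morph t :
  Delta (tmap alpha beta t) =
  \tsum_(x ⊗ y <- Delta t) tmap alpha beta x ⊗ tmap alpha beta y.
Proof.
move: t; apply: tensor_ext; [prove_linear | prove_linear | move=> c h].
rewrite smash_comul_tlift; [|prove_linear|prove_linear].
rewrite tmapE {1}/Delta /= smash_comulE.
rewrite (hcoalg_morph hCc) tlift_tlift; [|prove_linear|prove_linear].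
apply: eq_tlift => c1 c2; rewrite tliftE; [|prove_linear|prove_linear].
rewrite (hcomod_morph hCm) tlift_tlift; [|prove_linear|prove_linear].
apply: eq_tlift => k c20; rewrite tliftE; [|prove_linear|prove_linear].
rewrite (hcoalg_morph hHc) tlift_tlift; [|prove_linear|prove_linear].
apply: eq_tlift => h1 h2; rewrite tliftE; [|prove_linear|prove_linear].
by rewrite !tmapE (halg_morphM hA) !linKv // !linvK.
Qed.

Lemma smash_counit_tmap t :
  smash_counit epsC epsH (tmap alpha beta t) = smash_counit epsC epsH t.
Proof.
(* The field is taken as a module over itself, so that extensionality on pure tensors applies to the
   counit. *)
move: t; apply: (@tensor_ext _ _ _ K^o
  (fun t => smash_counit epsC epsH (tmap alpha beta t)) (smash_counit epsC epsH)).
- by move=> a x y; rewrite !linearP.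
- by move=> a x y; rewrite linearP.
- by move=> c h; rewrite tmapE !smash_counitE (hcoalg_eps hCc) (hcoalg_eps hHc).
Qed.

(** * Counit laws *)

Lemma smash_comul_counitl t :
  \tsum_(x ⊗ y <- Delta t) smash_counit epsC epsH x *: y = tmap alpha beta t.
Proof.
move: t; apply: tensor_ext; [prove_linear | prove_linear | move=> c h].
rewrite smash_comul_tlift; [|prove_linear|prove_linear].
rewrite tmapE -(hcoalg_counitl hCc).
rewrite (@linear_tlift _ _ _ _ _ (fun x => x ⊗ _)); last by prove_linear.
(* Here c_2 = alpha^-1(alpha(c_2)), and alpha(c_2) is opened by the counit law of [rho]; next
   beta(h) is opened by that of [DeltaH]. *)
apply: eq_tlift => c1 c2; rewrite -[c2 in RHS](linKv abij) -(hcomod_counit hCm).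
rewrite (@linear_tlift _ _ _ _ _ (fun x => (epsC c1 *: x^a) ⊗ _));
  last by prove_linear.
apply: eq_tlift => k c20; rewrite -(hcoalg_counitl hHc).
rewrite (@linear_tlift _ _ _ _ _ (fun x => _ ⊗ x)); last by prove_linear.
apply: eq_tlift => h1 h2; rewrite [smash_counit _ _ _]smash_counitE.
(* [epsH] is multiplicative and invariant under [beta], so its value at k.beta^-1(h_1) is that at k
   times that at h_1. *)
rewrite (hbialg_counitM hH) -(hcoalg_eps hHc h1^b) linvK // linearZ /=.
by rewrite !tensZl tensZr !scalerA mulrA.
Qed.

Lemma smash_comul_counitr t :
  \tsum_(x ⊗ y <- Delta t) smash_counit epsC epsH y *: x = tmap alpha beta t.
Proof.
move: t; apply: tensor_ext; [prove_linear | prove_linear | move=> c h].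
rewrite smash_comul_tlift; [|prove_linear|prove_linear].
rewrite tmapE -(hcoalg_counitr hCc).
rewrite (@linear_tlift _ _ _ _ _ (fun x => x ⊗ _)); last by prove_linear.
apply: eq_tlift => c1 c2; rewrite tensZl.
rewrite -tensZr -(linvK bbij (beta h)) linKv //.
(* Reading beta(h) as 1_H.h makes eps(c_2) 1_H appear, which is then expanded as c_{2,-1}
   eps(c_{2,0}). *)
rewrite -(halg_mul1r hA) -linearZ -tensZl.
rewrite -(chcoalg_counit hC).
rewrite (@linear_tlift _ _ _ _ _ (fun x => c1 ⊗ (x ⋅ h))); last by prove_linear.
apply: eq_tlift => k c20; rewrite -[h in RHS](linKv bbij) -(hcoalg_counitr hHc).
rewrite (@linear_tlift _ _ _ _ _ (fun x => c1 ⊗ ((_ *: k) ⋅ x^b)));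
  last by prove_linear.
apply: eq_tlift => h1 h2; rewrite [smash_counit _ _ _]smash_counitE.
rewrite -(hcoalg_eps hCc c20^a) linvK // linearZ /=.
rewrite !tensZl !tensZr !linearZ /=.
by rewrite !tensZr !scalerA.
Qed.

(** * Coassociativity *)

Let G (a : C) (b : H) (c : C) (d : H) (p : C) (q : H) :=
  (a ⊗ b) ⊗ (c ⊗ d) ⊗ (p ⊗ q).

(** The common form of both sides, as a function of a = alpha(c_1), b = c_{21,-1}.c_{22,-1}, p =
    c_{21,0} and q = c_{22,0}. *)
Let mid h (a : C) (b : H) (p q : C) :=
  \tsum_(l ⊗ q0 <- rho q) \tsum_(h1 ⊗ h2 <- DeltaH h)
  \tsum_(h21 ⊗ h22 <- DeltaH h2)
    G a (b^b ⋅ h1) p^a (l^b ⋅ h21^b) (q0^a)^a h22.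

Lemma smash_comul_coassocl c h :
  \tsum_(x ⊗ y <- Delta (c ⊗ h)) \tsum_(y1 ⊗ y2 <- Delta y)
    tmap alpha beta x ⊗ y1 ⊗ y2
  = \tsum_(c1 ⊗ c2 <- DeltaC c) \tsum_(c21 ⊗ c22 <- DeltaC c2)
    \tsum_(h1 ⊗ c10 <- rho c21) \tsum_(h2 ⊗ c20 <- rho c22)
    mid h (alpha c1) (h1 ⋅ h2) c10 c20.
Proof.
rewrite smash_comul_tlift; [|prove_linear|prove_linear].
apply: eq_tlift => c1 c2.
(* Read from right to left, the compatibility replaces [b] in [mid] by beta^2(c_{2,-1}); its beta^-1
   is the beta(c_{2,-1}) found on the left. *)
rewrite -(chcoalg_comul_tlift _ hC); last first.
  by rewrite /mid /G; split; prove_linear.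
apply: eq_tlift => k c20.
under eq_tlift => h1 h2 do
  [rewrite smash_comul_tlift; [|prove_linear|prove_linear];
   rewrite (tlift_linv _ abij abij abij (hcoalg_morph hCc));
     [|prove_linear|prove_linear]].
rewrite exchange_tlift; apply: eq_tlift => p q.
under eq_tlift => h1 h2 do
  [rewrite (tlift_linv _ abij bbij abij (hcomod_morph hCm));
     [|prove_linear|prove_linear]].
rewrite exchange_tlift; apply: eq_tlift => l q0.
apply: eq_tlift => h1 h2; apply: eq_tlift => h21 h22.
by rewrite /G tmapE (halg_morphM hA) linvK // linKv.
Qed.

Lemma smash_comul_coassocr c h :
  \tsum_(x ⊗ y <- Delta (c ⊗ h)) \tsum_(x1 ⊗ x2 <- Delta x)
    x1 ⊗ x2 ⊗ tmap alpha beta y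
  = \tsum_(c1 ⊗ c2 <- DeltaC c) \tsum_(c21 ⊗ c22 <- DeltaC c2)
    \tsum_(h1 ⊗ c10 <- rho c21) \tsum_(h2 ⊗ c20 <- rho c22)
    mid h (alpha c1) (h1 ⋅ h2) c10 c20.
Proof.
(* The alpha^-1 on [y] gives the sum the shape Psi(c_{11}, c_{12}, alpha(c_2)) required by
   coassociativity of C. *)
pose Psi (a b y : C) := \tsum_(k' ⊗ p <- rho b) \tsum_(k ⊗ q <- rho y^a)
  \tsum_(k1 ⊗ k2 <- DeltaH k) \tsum_(h1 ⊗ h2 <- DeltaH h)
  \tsum_(h11 ⊗ h12 <- DeltaH h1)
    G a (k' ⋅ (k1 ⋅ h11^b)^b) p^a (k2 ⋅ h12^b) q (beta h2).
transitivity (\tsum_(c1 ⊗ c2 <- DeltaC c) \tsum_(c11 ⊗ c12 <- DeltaC c1)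
   Psi c11 c12 (alpha c2)).
  rewrite smash_comul_tlift; [|prove_linear|prove_linear].
  apply: eq_tlift => c1 c2; rewrite /Psi linKv //.
  under eq_tlift => k q do under eq_tlift => h1 h2 do
    [rewrite smash_comul_tlift; [|prove_linear|prove_linear];
     rewrite tmapE linvK //].
  under eq_tlift => k q do rewrite exchange_tlift.
  rewrite exchange_tlift; apply: eq_tlift => c11 c12.
  under eq_tlift => k q do rewrite exchange_tlift.
  rewrite exchange_tlift; apply: eq_tlift => k' p; apply: eq_tlift => k q.
  rewrite [RHS]exchange_tlift; apply: eq_tlift => h1 h2.
  rewrite (hbialg_comulM_tlift _ _ hH); [|prove_linear|prove_linear].
  apply: eq_tlift => k1 k2.
  by rewrite (tlift_linv _ bbij bbij bbij (hcoalg_morph hHc));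
    [|prove_linear|prove_linear].
rewrite -(hcoalg_coassoc_tlift _ hCc); last first.
  by rewrite /Psi /G; split; prove_linear.
apply: eq_tlift => c1 c2; apply: eq_tlift => b y; apply: eq_tlift => k' p.
rewrite /G (tlift_linv _ abij bbij abij (hcomod_morph hCm));
  [|prove_linear|prove_linear].
under eq_tlift => k q do
  [rewrite (tlift_linv _ bbij bbij bbij (hcoalg_morph hHc));
     [|prove_linear|prove_linear]].
(* The same device for [rho]: one extra alpha^-1 on [z] leaves room for the alpha in its
   coassociativity. *)
pose F (x y : H) (z : C) := \tsum_(h1 ⊗ h2 <- DeltaH h)
  \tsum_(h11 ⊗ h12 <- DeltaH h1)
  G (alpha c1) (k' ⋅ (x^b ⋅ h11^b)^b) p^a (y^b ⋅ h12^b) (z^a)^a (beta h2).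
transitivity (\tsum_(k ⊗ q <- rho y)
    \tsum_(k1 ⊗ k2 <- DeltaH k) F k1 k2 (alpha q)).
  by apply: eq_tlift => k q; apply: eq_tlift => k1 k2; rewrite /F linKv.
rewrite -(hcomod_coassoc_tlift _ hCm); last by rewrite /F /G; split; prove_linear.
apply: eq_tlift => k q; apply: eq_tlift => l q0; rewrite /F.
(* Coassociativity of H turns (h_{11}, h_{12}, beta(h_2)) into (beta(h_1), h_{21}, h_{22});
   [mul_linvA] then regroups the product. *)
rewrite -(hcoalg_coassoc_tlift (F := fun h11 h12 h2 =>
    G _ (_ ⋅ (_ ⋅ h11^b)^b) _ (_ ⋅ h12^b) _ h2) _ hHc);
  last by rewrite /G; split; prove_linear.
apply: eq_tlift => h1 h2; apply: eq_tlift => h21 h22.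
by rewrite !linKv // mul_linvA.
Qed.

Lemma smash_comul_coassoc t :
  \tsum_(x ⊗ y <- Delta t) \tsum_(y1 ⊗ y2 <- Delta y)
    tmap alpha beta x ⊗ y1 ⊗ y2
  = \tsum_(x ⊗ y <- Delta t) \tsum_(x1 ⊗ x2 <- Delta x)
    x1 ⊗ x2 ⊗ tmap alpha beta y.
Proof.
move: t; apply: tensor_ext; [prove_linear | prove_linear | move=> c h].
by rewrite smash_comul_coassocl smash_comul_coassocr.
Qed.

End SmashCoproduct.

(** * The Hom-coalgebra structure assembled *)

Theorem proposition3p1 (K : fieldType) (H C : lmodType K)
    (mu : {linear H ⨂ H -> H}) (e : H) (DeltaH : {linear H -> H ⨂ H})
    (epsH : {scalar H}) (beta : {linear H -> H})
    (DeltaC : {linear C -> C ⨂ C}) (epsC : {scalar C})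
    (rho : {linear C -> H ⨂ C}) (alpha : {linear C -> C})
    (hH : hom_bialgebra mu e DeltaH epsH beta)
    (hC : comodule_hom_coalgebra mu e DeltaH epsH beta DeltaC epsC rho alpha) :
  hom_coalgebra (smash_comul mu DeltaH beta DeltaC rho alpha)
    (smash_counit epsC epsH) (tmap alpha beta).
Proof.
split.
- exact: tmap_bij (hcoalg_bij (chcoalg_coalg hC))
    (hcoalg_bij (hbialg_coalg hH)).
- exact: smash_comul_morph hH hC.
- exact: smash_counit_tmap hH hC.
- exact: smash_comul_coassoc hH hC.
- exact: smash_comul_counitl hH hC.
- exact: smash_comul_counitr hH hC.
Qed.
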